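(* Let $n$ be a positive integer such that, for a ground set $\mathcal{Y}$ with $|\mathcal{Y}|=n$, every vector in the closure of the minimal convex cone containing all representable rank functions on $\mathcal{Y}$ is almost representable. Let $(c_\alpha)_{\alpha\subseteq\{1,\dots,n\}}$ be real numbers such that $\sum_{\alpha\subseteq\{1,\dots,n\}}c_\alpha\, H(V_i:i\in\alpha)\ge0$ for all subspaces $V_1,\dots,V_n$ of any vector space over any finite field. Let $(\mathcal{X},\mathbf{h})$ be any cc-representable polymatroid, let $0\le\epsilon\le\mathbf{h}(\mathcal{X})$, and let $\mathbf{g}(\mathcal{A})=\min(\mathbf{h}(\mathcal{A}),\mathbf{h}(\mathcal{X})-\epsilon)$. Then $\sum_{\alpha}c_\alpha\,\mathbf{g}\big(\bigcup_{i\in\alpha}\mathcal{V}_i\big)\ge0$ for all subsets $\mathcal{V}_1,\dots,\mathcal{V}_n\subseteq\mathcal{X}$. Consequently, the polymatroid $(\mathcal{X},\Phi^\epsilon)$ described below satisfies every such inequality, and hence the set of all such inequalities (for this $n$) is not sufficient to characterize cc-representable polymatroids in general: $(\mathcal{X},\Phi^\epsilon)$ satisfies all of them but is not cc-representable. Here $(\mathcal{X},\Phi^\epsilon)$ is defined as follows. Let $\mathcal{X}_1=\{Y_1,Y_2,Y_3,W_1,\dots,W_4\}$ be the subspaces $\langle u_1\rangle,\langle u_2\rangle,\langle u_3\rangle,\langle u_1+u_2\rangle,\langle u_2+u_3\rangle,\langle u_1+u_2+u_3\rangle,\langle u_1+u_3\rangle$ for linearly independent $u_1,u_2,u_3$ over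 a finite field of characteristic $2$, with $\Phi_1(\mathcal{A})=\dim\langle\mathcal{A}\rangle$; let $\mathcal{X}_2=\{Z_1,\dots,Z_5,V_1,\dots,V_8\}$ be $\langle u'_1\rangle,\dots,\langle u'_5\rangle,\langle u'_1+u'_2+u'_3\rangle,\langle u'_3+u'_4+u'_5\rangle,\langle u'_1+u'_2\rangle,\langle u'_1+u'_3\rangle,\langle u'_2+u'_3\rangle,\langle u'_3+u'_4\rangle,\langle u'_3+u'_5\rangle,\langle u'_4+u'_5\rangle$ for linearly independent $u'_1,\dots,u'_5$ over a finite field of odd characteristic, with $\Phi_2(\mathcal{A})=\dim\langle\mathcal{A}\rangle$; let $\mathcal{X}=\mathcal{X}_1\sqcup\mathcal{X}_2$, $\Phi(\mathcal{A})=\Phi_1(\mathcal{A}\cap\mathcal{X}_1)+\Phi_2(\mathcal{A}\cap\mathcal{X}_2)$, and $\Phi^\epsilon(\mathcal{A})=\min(\Phi(\mathcal{A}),\Phi(\mathcal{X})-\epsilon)$ with $0<\epsilon\le\min(\Phi_1(\mathcal{X}_1),\Phi_2(\mathcal{X}_2))$.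
   Context: $H(V_i:i\in\alpha)=\dim\langle V_i:i\in\alpha\rangle$ ($\langle\cdot\rangle$ = span). A polymatroid $(\mathcal{X},\mathbf{h})$ is a finite ground set $\mathcal{X}=\{X_1,\dots,X_m\}$ with $\mathbf{h}:2^{\mathcal{X}}\to\mathbb{R}_{\ge0}$ satisfying $\mathbf{h}(\emptyset)=0$, monotonicity and submodularity. It is representable if for some finite field $\mathbb{F}_q$ there are subspaces $U_1,\dots,U_m$ of an $\mathbb{F}_q$-vector space with $\mathbf{h}(\{X_i:i\in\alpha\})=\dim\langle U_i:i\in\alpha\rangle$ for all $\alpha$. Rank functions are vectors in $\mathbb{R}^{2^{|\mathcal{X}|}}$. A rank function is almost representable if it equals $\lim_{i\to\infty}c_i\mathbf{g}_i$ with $\mathbf{g}_i$ representable and $c_i>0$; it is cc-representable if it lies in the closure of the minimal convex cone containing all representable rank functions on its ground set. *)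

(* Defs.v *)
From HB Require Import structures.
From mathcomp Require Import all_boot all_order all_algebra all_field.
From mathcomp Require Import all_classical all_reals all_analysis.

Set Implicit Arguments.
Unset Strict Implicit.
Unset Printing Implicit Defensive.

Import Order.TTheory GRing.Theory Num.Theory.
Import numFieldNormedType.Exports.
Local Open Scope ring_scope.

Section Polymatroids.
Variable R : realType.

Definition polymatroid (X : finType) (h : {set X} -> R) : Prop :=
  [/\ h finset.set0 = 0,
      (forall A, 0 <= h A),
      (forall A B : {set X}, A \subset B -> h A <= h B) &
      (forall A B : {set X}, h (A :|: B) + h (A :&: B) <= h A + h B)].

(* Representable: there is a finite field F and subspaces U_x (x in X) of a
   (finite-dimensional) F-vector space F^k, subspace U_x given as the row
   space of the square matrix U x, such that h A = dim <U_x : x in A>. *)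
Definition representable (X : finType) (h : {set X} -> R) : Prop :=
  exists (F : finFieldType) (k : nat) (U : X -> 'M[F]_k),
    forall A : {set X}, h A = (\rank (\sum_(x in A) U x)%MS)%:R.

Definition almost_representable (X : finType) (h : {set X} -> R) : Prop :=
  exists (g : nat -> {set X} -> R) (c : nat -> R),
    [/\ (forall i, representable (g i)),
        (forall i, 0 < c i) &
        (forall A : {set X}, ((fun i => c i * g i A) @ \oo --> h A)%classic)].

Definition in_rep_cone (X : finType) (f : {set X} -> R) : Prop :=
  exists (m : nat) (l : 'I_m -> R) (g : 'I_m -> {set X} -> R),
    [/\ (forall j, 0 <= l j),
        (forall j, representable (g j)) &
        (forall A : {set X}, f A = \sum_(j < m) l j * g j A)].

(* cc-representable: in the closure (in R^(2^X), finite-dimensional, so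
   sequential closure) of that cone. *)
Definition cc_representable (X : finType) (h : {set X} -> R) : Prop :=
  exists f : nat -> {set X} -> R,
    (forall i, in_rep_cone (f i)) /\
    (forall A : {set X}, ((fun i => f i A) @ \oo --> h A)%classic).

Definition lin_rank_ineq (n : nat) (c : {set 'I_n} -> R) : Prop :=
  forall (F : finFieldType) (k : nat) (V : 'I_n -> 'M[F]_k),
    0 <= \sum_(a : {set 'I_n}) c a * (\rank (\sum_(i in a) V i)%MS)%:R.

Definition satisfies_ineq (n : nat) (c : {set 'I_n} -> R)
    (X : finType) (h : {set X} -> R) : Prop :=
  forall V : 'I_n -> {set X},
    0 <= \sum_(a : {set 'I_n}) c a * h (\bigcup_(i in a) V i).

Definition truncate (X : finType) (h : {set X} -> R) (eps : R)
    : {set X} -> R :=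
  fun A => Num.min (h A) (h [set: X] - eps).

End Polymatroids.

(* Supports of the combinations of basis vectors (0-indexed).
   X1 = Y1 Y2 Y3 W1 W2 W3 W4 :
   u1, u2, u3, u1+u2, u2+u3, u1+u2+u3, u1+u3. *)
Definition supp1 (i : nat) : seq nat :=
  match i with
  | 0 => [:: 0] | 1 => [:: 1] | 2 => [:: 2]
  | 3 => [:: 0; 1] | 4 => [:: 1; 2] | 5 => [:: 0; 1; 2] | 6 => [:: 0; 2]
  | _ => [::] end.

(* X2 = Z1..Z5 V1..V8 :
   u1..u5, u1+u2+u3, u3+u4+u5, u1+u2, u1+u3, u2+u3, u3+u4, u3+u5, u4+u5. *)
Definition supp2 (i : nat) : seq nat :=
  match i with
  | 0 => [:: 0] | 1 => [:: 1] | 2 => [:: 2] | 3 => [:: 3] | 4 => [:: 4]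
  | 5 => [:: 0; 1; 2] | 6 => [:: 2; 3; 4]
  | 7 => [:: 0; 1] | 8 => [:: 0; 2] | 9 => [:: 1; 2]
  | 10 => [:: 2; 3] | 11 => [:: 2; 4] | 12 => [:: 3; 4]
  | _ => [::] end.

Definition elt_vec (F : fieldType) (m k : nat) (supp : nat -> seq nat)
    (u : 'M[F]_(m, k)) (e : nat) : 'rV[F]_k :=
  \sum_(j < m | nat_of_ord j \in supp e) row j u.

Definition Phi_part (F : fieldType) (m k N : nat) (supp : nat -> seq nat)
    (u : 'M[F]_(m, k)) (A : {set 'I_N}) : nat :=
  \rank (\sum_(e in A) <<elt_vec supp u e>>)%MS.

Definition Phi1 (F : fieldType) (k : nat) (u : 'M[F]_(3, k)) (A : {set 'I_7})
  : nat := Phi_part supp1 u A.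

Definition Phi2 (F : fieldType) (k : nat) (u : 'M[F]_(5, k)) (A : {set 'I_13})
  : nat := Phi_part supp2 u A.

Definition Phi (R : realType) (F1 F2 : fieldType) (k1 k2 : nat)
    (u1 : 'M[F1]_(3, k1)) (u2 : 'M[F2]_(5, k2))
    (A : {set ('I_7 + 'I_13)%type}) : R :=
  (Phi1 u1 [set x | inl x \in A])%:R + (Phi2 u2 [set x | inr x \in A])%:R.

Definition Phi_eps (R : realType) (F1 F2 : fieldType) (k1 k2 : nat)
    (u1 : 'M[F1]_(3, k1)) (u2 : 'M[F2]_(5, k2)) (eps : R)
    : {set ('I_7 + 'I_13)%type} -> R :=
  truncate (Phi R u1 u2) eps.

(* Main.v *)
Require Import Defs.
From HB Require Import structures.
From mathcomp Require Import all_boot all_order all_algebra all_field.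
From mathcomp Require Import all_classical all_reals all_analysis.
From mathcomp Require Import zify ring lra.
Set Implicit Arguments.
Unset Strict Implicit.
Unset Printing Implicit Defensive.
Import Order.TTheory GRing.Theory Num.Theory.
Import numFieldNormedType.Exports.
Local Open Scope ring_scope.

(** Truncation: quotienting a representation by a generic vector of its total
    span, over a large enough extension field, lowers by one exactly the ranks
    that are maximal. Hence [min (N * g, r)] is representable whenever [g] is,
    for all naturals [N] and [r]; dividing by [N] and passing to the limit, a
    linear rank inequality holds for [min (g, t)] for every real [t >= 0], and
    then for the truncation of every almost representable function.

    Non-representability of [Phi_eps]: for subspaces playing the roles of
    [u1], [u2], [u3], [u1 + u2 + u3], [u2 + u3], [u1 + u3], [u1 + u2], consider
    the space of triples (a, b, c) satisfying the same incidences. Its dimension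
    is bounded from below up to conditional mutual informations that vanish on
    both matroids. In characteristic 2 it is bounded from above by terms
    vanishing on the non-Fano matroid, because (b + c) + (a + c) + (a + b) = 0;
    otherwise by terms vanishing on the Fano matroid, because
    2c = (b + c) + (a + c) - (a + b). So a representable [g] satisfies
    [g X2 <= D2 g] or [g X1 <= D1 g], where [D1] and [D2] are nonnegative linear
    forms vanishing on [Phi1] and [Phi2]. In both cases
    [g X1 + g X2 <= g X + D1 g + D2 g], an inequality that persists in the
    closed convex cone and that [Phi_eps] violates by [eps]. *)

(** * Generic truncation of representable rank functions *)

(** The product of all ['X - a], increased by 1, takes the value 1 on all of [F]. It has no root
    there, so its splitting field is strictly larger. *)
Lemma finField_extension_gt (F : finFieldType) :
  exists (F' : finFieldType) (f : {rmorphism F -> F'}), (#|F| < #|F'|)%N.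
Proof.
pose q : {poly F} := \prod_(a <- enum F) ('X - a%:P).
have szq : size q = #|F|.+1 by rewrite /q size_prod_XsubC -cardE.
have szp : size (q + 1) = #|F|.+1.
  by rewrite size_polyDl szq // size_poly1 ltnS; apply/card_gt0P; exists 0.
have p_neq0 : q + 1 != 0 by rewrite -size_poly_eq0 szp.
have p_noroot a : ~~ root (q + 1) a.
  rewrite rootE hornerD hornerC; have /rootP-> : root q a.
    by rewrite root_prod_XsubC mem_enum.
  by rewrite add0r oner_eq0.
have [L [rs p_split _]] := FinSplittingFieldFor p_neq0.
have rs_neq0 : (0 < size rs)%N.
  move: (eqp_size p_split); rewrite size_prod_XsubC size_map_poly szp => -[<-].
  by apply/card_gt0P; exists 0.
pose z := nth 0 rs 0; have z_root : root (map_poly (in_alg L) (q + 1)) z.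
  by rewrite (eqp_root p_split) root_prod_XsubC mem_nth.
pose F' : finFieldType := FinFieldExtType L.
pose f : {rmorphism F -> F'} := in_alg L; exists F', f.
have f_inj : injective f by apply: fmorph_inj.
rewrite ltn_neqAle -{2}(card_codom f_inj) max_card andbT.
apply/negP => /eqP eqFF'.
have /codomP[a za] : (z : F') \in codom f.
  by rewrite (inj_card_onto f_inj) ?eqFF'.
have := p_noroot a; rewrite -(fmorph_root (in_alg L)).
by move: z_root; rewrite za => ->.
Qed.

Lemma finField_extension_big (F : finFieldType) (N : nat) :
  exists (F' : finFieldType) (f : {rmorphism F -> F'}), (N < #|F'|)%N.
Proof.
elim: N => [|N [F1 [f1 ltN]]].
  by exists F, idfun; apply/card_gt0P; exists 0.
have [F2 [f2 lt12]] := finField_extension_gt F1.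
exists F2, (f2 \o f1); exact: leq_ltn_trans lt12.
Qed.

(** * Spans and operations on rank functions *)

Section RankFun.
Variables (F : fieldType) (X : finType) (k : nat) (U : X -> 'M[F]_k).

Definition spn (A : {set X}) : 'M[F]_k := (\sum_(x in A) U x)%MS.

Lemma spnS (A B : {set X}) : A \subset B -> (spn A <= spn B)%MS.
Proof.
move=> /fintype.subsetP sAB; apply/sumsmx_subP => x xA.
exact: (sumsmx_sup x (sAB _ xA)).
Qed.

Lemma spnU (A B : {set X}) : (spn (A :|: B) :=: spn A + spn B)%MS.
Proof.
apply/eqmxP/andP; split; last first.
  by rewrite addsmx_sub !spnS ?finset.subsetUl ?finset.subsetUr.
apply/sumsmx_subP => x /finset.setUP[] xA.
  by apply: submx_trans (addsmxSl _ _); apply: (sumsmx_sup x).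
by apply: submx_trans (addsmxSr _ _); apply: (sumsmx_sup x).
Qed.

Lemma spn1 (x : X) : (spn [set x] = U x)%MS.
Proof. exact: big_set1. Qed.

Lemma spn0 : spn finset.set0 = 0.
Proof. exact: big_set0. Qed.
End RankFun.

Lemma rank_fun_add (F : fieldType) (X : finType) (k1 k2 : nat)
    (U1 : X -> 'M[F]_k1) (U2 : X -> 'M[F]_k2) :
  exists U : X -> 'M[F]_(k1 + k2), forall A,
    \rank (spn U A) = (\rank (spn U1 A) + \rank (spn U2 A))%N.
Proof.
exists (fun x => block_mx (U1 x) 0 0 (U2 x)) => A.
have -> : (\rank (spn (fun x => block_mx (U1 x) 0 0 (U2 x)) A) =
  \rank (block_mx (spn U1 A) 0 0 (spn U2 A)))%N.
  apply: eqmx_rank; pose i1 : 'M[F]_(k1, k1 + k2) := row_mx 1%:M 0.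
  pose i2 : 'M[F]_(k2, k1 + k2) := row_mx 0 1%:M.
  (* A block-diagonal row space is the sum of its images under the two coordinate injections, and
     these commute with sums of subspaces. *)
  have E (B1 : 'M[F]_k1) (B2 : 'M[F]_k2) :
      (block_mx B1 0 0 B2 :=: B1 *m i1 + B2 *m i2)%MS.
    rewrite /block_mx !mul_mx_row !mulmx1 !mulmx0.
    by apply: eqmx_sym; apply: addsmxE.
  apply/andP; split; last rewrite E.
    apply/sumsmx_subP => x xA; rewrite !E addsmxS // submxMr //;
      exact: (sumsmx_sup x).
  rewrite addsmx_sub; apply/andP; split; rewrite sumsmxMr_gen;
    apply/sumsmx_subP => x xA; rewrite genmxE; apply: (sumsmx_sup x) => //;
    rewrite E; [exact: addsmxSl | exact: addsmxSr].
by rewrite rank_diag_block_mx.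
Qed.

Lemma rank_fun_muln (F : fieldType) (X : finType) (k : nat)
    (U : X -> 'M[F]_k) (N : nat) :
  exists (k' : nat) (U' : X -> 'M[F]_k'), forall A,
    \rank (spn U' A) = (N * \rank (spn U A))%N.
Proof.
elim: N => [|N [k' [U' IH]]].
  by exists 0%N, (fun=> 0) => A; apply/eqP; rewrite -leqn0 rank_leq_row.
have [V HV] := rank_fun_add U U'.
by exists (k + k')%N, V => A; rewrite HV IH mulSn.
Qed.

Lemma rank_fun_map (F F' : fieldType) (f : {rmorphism F -> F'}) (X : finType)
    (k : nat) (U : X -> 'M[F]_k) (A : {set X}) :
  \rank (spn (fun x => map_mx f (U x)) A) = \rank (spn U A).
Proof.
rewrite -(mxrank_map f); apply/eqmx_rank/eqmxP/eqmx_sym.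
rewrite /spn; elim/big_ind2: _ => [|B1 C1 B2 C2 e1 e2|x _];
  [by rewrite map_mx0 | | exact: eqmx_refl].
by apply: eqmx_trans (map_addsmx _ _ _) _; apply: adds_eqmx.
Qed.

(** The candidates are the vectors (1, x, x^2, ...) times [T]. A nonzero column of
    [T *m cokermx (W i)] is the coefficient vector of a nonzero polynomial vanishing at every x
    whose candidate lies in [W i]. Together these polynomials have at most [#|I| * k] roots, fewer
    than [F] has elements. *)
Lemma generic_vector (F : finFieldType) (k : nat) (I : finType)
    (T : 'M[F]_k) (W : I -> 'M[F]_k) :
  (#|I| * k < #|F|)%N -> (forall i, ~~ (T <= W i)%MS) ->
  exists v : 'rV[F]_k, (v <= T)%MS /\ forall i, ~~ (v <= W i)%MS.
Proof.
move=> ltF nTW; pose w x : 'rV[F]_k := \row_i x ^+ i.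
have /fin_all_exists[p Hp] i : exists p : {poly F}, [/\ p != 0, (size p <= k)%N
    & forall x, (w x *m T <= W i)%MS -> root p x].
  pose M := T *m cokermx (W i).
  have [j nzM] : exists j, col j M != 0.
    apply/existsP; move: (nTW i); rewrite submxE; apply: contraR.
    rewrite negb_exists => /forallP H; apply/eqP/matrixP => a b.
    by have /eqP/colP/(_ a) := negbNE (H b); rewrite !mxE.
  exists (rVpoly (col j M)^T); split; [|exact: size_poly|].
    apply: contraNneq nzM => p0.
    apply/eqP/trmx_inj/(can_inj rVpolyK); rewrite trmx0 linear0; exact: p0.
  move=> x; rewrite submxE -mulmxA => /eqP wM0; rewrite rootE.
  have := congr1 (fun N : 'rV_k => N 0 j) wM0.
  rewrite !mxE => <-; rewrite horner_poly; apply/eqP/eq_bigr => a _.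
  by rewrite valK !mxE mulrC.
pose q := \prod_i p i.
have q_neq0 : q != 0 by apply/prodf_neq0 => i _; have [] := Hp i.
have [x nqx] : exists x, ~~ root q x.
  apply/existsP; apply: contraLR ltF; rewrite negb_exists -leqNgt => /forallP qr.
  have q_all : all (root q) (enum F) by apply/allP => x _; apply: negbNE.
  rewrite cardE -ltnS (leq_trans (max_poly_roots q_neq0 q_all (enum_uniq F))) //.
  rewrite (leq_trans (size_poly_prod_leq _ _)) // leq_subLR.
  rewrite addnS ltnS (leq_trans _ (leq_addl _ _)) //.
  by rewrite -sum_nat_const; apply: leq_sum => i _; have [] := Hp i.
exists (w x *m T); split=> [|i]; first exact: submxMl.
apply: contra nqx => /(let: And3 _ _ H := Hp i in H x) /rootP px0.
by rewrite rootE horner_prod (bigD1 i) //= px0 mul0r.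
Qed.

Lemma kermx_cokermx (F : fieldType) (m n : nat) (M : 'M[F]_(m, n)) :
  (kermx (cokermx M) :=: M)%MS.
Proof.
apply/eqmxP/andP; split; last by apply/sub_kermxP; apply: mulmx_coker.
by rewrite submxE mulmx_ker.
Qed.

(** Passing to the quotient by a nonzero [v] lowers the rank of a span by one exactly when the span
    contains [v]. A [v] in the total span that avoids every proper span of a subset therefore
    affects only the sets of full rank. *)
Lemma rank_fun_truncate1 (F : finFieldType) (X : finType) (k : nat)
    (U : X -> 'M[F]_k) (r : nat) : \rank (spn U finset.setT) = r.+1 ->
  exists (F' : finFieldType) (U' : X -> 'M[F']_k), forall A,
    \rank (spn U' A) = minn (\rank (spn U A)) r.
Proof.
move=> rT; have [F' [f bigF']] := finField_extension_big F (#|{set X}| * k).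
pose U1 x := map_mx f (U x).
pose P A := ~~ (spn U1 finset.setT <= spn U1 A)%MS.
have [||v [vT vW]] := @generic_vector F' k {A | P A} (spn U1 finset.setT)
    (fun A => spn U1 (val A)).
- apply: leq_ltn_trans bigF'; rewrite leq_mul2r card_sig max_card orbT //.
- by case.
exists F', (fun x => U1 x *m cokermx v) => A.
have -> : \rank (spn (fun x => U1 x *m cokermx v) A) =
    \rank (spn U1 A *m cokermx v).
  by apply/esym/eqmx_rank/eqmxP; apply: sumsmxMr.
have := mxrank_mul_ker (spn U1 A) (cokermx v).
have eqA : \rank (spn U1 A) = \rank (spn U A) by apply: rank_fun_map.
rewrite (eqmx_rank (introT eqmxP
  (cap_eqmx (eqmx_refl _) (kermx_cokermx v)))) eqA.
have sAT : (spn U1 A <= spn U1 finset.setT)%MS.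
  by apply: spnS; rewrite finset.subsetT.
have rT1 : \rank (spn U1 finset.setT) = r.+1 by rewrite rank_fun_map.
(* [v] is nonzero because the span of the empty set is among those avoided. *)
have v1 : \rank v = 1%N.
  apply/eqP; rewrite eqn_leq rank_leq_row lt0n mxrank_eq0.
  have P0 : P finset.set0 by rewrite /P spn0 submx0 -mxrank_eq0 rT1.
  by have := vW (exist _ finset.set0 P0); rewrite /= spn0 submx0.
have [PA|] := boolP (P A); last first.
  rewrite negbK => sTA; have /eqmx_rank := introT andP (conj sAT sTA).
  rewrite eqA rT1 => ->; rewrite (_ : \rank (_ :&: v) = 1%N).
    by rewrite addn1 => -[->]; apply/esym/minn_idPr.
  by rewrite (capmx_idPr _) // (submx_trans vT).
have ltA : (\rank (spn U A) < r.+1)%N.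
  rewrite -eqA -rT1 ltn_neqAle mxrankS // andbT.
  by apply: contra PA => /eqP eqr; rewrite -(mxrank_leqif_sup sAT).2 eqr.
rewrite (_ : \rank (_ :&: v) = 0%N).
  by rewrite addn0 => ->; apply/esym/minn_idPl.
apply/eqP; rewrite -leqn0 -ltnS -[X in (_ < X)%N]v1 ltn_neqAle.
rewrite mxrankS ?capmxSr // andbT.
apply: contra (vW (exist _ A PA)) => /eqP eqv.
have := (mxrank_leqif_sup (capmxSr (spn U1 A) v)).2.
by rewrite eqv eqxx sub_capmx => /esym/andP[].
Qed.

(** Induction on the excess of the total rank over [r], each step removing one dimension; truncating
    at [t] and then at [r <= t] is truncating at [r]. *)
Lemma rank_fun_truncate (F : finFieldType) (X : finType) (k : nat)
    (U : X -> 'M[F]_k) (r : nat) :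
  exists (F' : finFieldType) (U' : X -> 'M[F']_k), forall A,
    \rank (spn U' A) = minn (\rank (spn U A)) r.
Proof.
have [m] := ubnP (\rank (spn U finset.setT) - r)%N.
elim: m F U => // m IH F U; rewrite ltnS => lem.
have leT (A : {set X}) : (\rank (spn U A) <= \rank (spn U finset.setT))%N.
  by apply/mxrankS/spnS/finset.subsetT.
have [leTr|ltrT] := leqP (\rank (spn U finset.setT)) r.
  by exists F, U => A; apply/esym/minn_idPl; apply: leq_trans leTr.
case eqT : (\rank (spn U finset.setT)) ltrT lem leT => [//|t] ltrt lem leT.
have [F1 [U1 H1]] := rank_fun_truncate1 eqT.
have [|F2 [U2 H2]] := IH F1 U1.
  by rewrite H1 eqT (minn_idPr _) //; apply: leq_trans lem; rewrite subSn.
by exists F2, U2 => A; rewrite H2 H1 -minnA (minn_idPr (n := r) _).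
Qed.

(** * Rank inequalities depending on the characteristic *)

Local Ltac in_sum := first
  [ assumption | exact: submx_refl
  | apply: submx_trans (addsmxSl _ _); in_sum
  | apply: submx_trans (addsmxSr _ _); in_sum ].
Local Ltac sum_sub := rewrite ?addsmx_sub; repeat (apply/andP; split); in_sum.

Lemma rank_mul_coker (F : fieldType) (m1 m2 k : nat) (M : 'M[F]_(m1, k))
    (W : 'M[F]_(m2, k)) :
  (\rank (M *m cokermx W) + \rank W = \rank (M + W)%MS)%N.
Proof.
have := mxrank_mul_ker M (cokermx W).
rewrite (eqmx_rank (introT eqmxP (cap_eqmx (eqmx_refl _) (kermx_cokermx W)))).
have := mxrank_sum_cap M W; lia.
Qed.

Lemma sub_kermx_mul_coker (F : fieldType) (m1 m2 n k : nat) (M : 'M[F]_(m1, n))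
    (Q : 'M[F]_(n, k)) (W : 'M[F]_(m2, k)) :
  (M <= kermx (Q *m cokermx W))%MS = (M *m Q <= W)%MS.
Proof. by rewrite [RHS]submxE -mulmxA; apply/sub_kermxP/eqP. Qed.

(** Rank-nullity for the map induced by [Q] from [S] to the quotient by [W]. *)
Lemma rank_preim_cap (F : fieldType) (m1 m2 n k : nat) (S : 'M[F]_(m1, n))
    (Q : 'M[F]_(n, k)) (W : 'M[F]_(m2, k)) :
  (\rank S + \rank W =
   \rank (S :&: kermx (Q *m cokermx W)) + \rank (S *m Q + W)%MS)%N.
Proof.
rewrite -rank_mul_coker -mulmxA -(mxrank_mul_ker S (Q *m cokermx W)); lia.
Qed.

Lemma rank_mul_cap_ker (F : fieldType) (m n k : nat) (S : 'M[F]_(m, n))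
    (Q : 'M[F]_(n, k)) (T : 'M[F]_k) : (S *m Q <= T)%MS ->
  (\rank S <= \rank T + \rank (S :&: kermx Q))%N.
Proof. by move=> sT; rewrite -(mxrank_mul_ker S Q) leq_add2r mxrankS. Qed.

Section CharacteristicInequalities.
Variables (F : fieldType) (k : nat) (A B C W X Y Z : 'M[F]_k).

(* [K] parametrises the triples (a, b, c) of A x B x C with a + b + c in W,
   a + b in Z, a + c in Y and b + c in X; its coordinates a, b, c are read off
   by [P], [Q], [R]. *)
Lemma triple_space : exists (n : nat) (K : 'M[F]_n) (P Q R : 'M[F]_(n, k)),
  [/\ [/\ (K *m P <= A)%MS, (K *m Q <= B)%MS & (K *m R <= C)%MS],
      [/\ (K *m (P + Q) <= Z)%MS, (K *m (P + R) <= Y)%MS &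
          (K *m (Q + R) <= X)%MS],
      (forall v : 'rV_n, v *m P = 0 -> v *m Q = 0 -> v *m R = 0 -> v = 0) &
      (\rank A + \rank B + \rank C + \rank W
        + (\rank (A + B + C + W + Z)%MS + \rank Z)
        + (\rank (A + B + C + W + Y)%MS + \rank Y)
        + (\rank (A + B + C + W + X)%MS + \rank X)
      <= \rank K + \rank (A + B + C + W)%MS
        + (\rank (A + B + Z)%MS + \rank (W + C + Z)%MS)
        + (\rank (A + C + Y)%MS + \rank (W + B + Y)%MS)
        + (\rank (B + C + X)%MS + \rank (W + A + X)%MS))%N].
Proof.
(* Triples are written in coordinates with respect to bases of [A], [B] and [C], so that a triple is
   determined by its images under [P], [Q] and [R]. *)
pose a : nat := \rank A; pose b : nat := \rank B; pose c : nat := \rank C.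
pose P : 'M[F]_(a + (b + c), k) := col_mx (row_base A) (col_mx 0 0).
pose Q : 'M[F]_(a + (b + c), k) := col_mx 0 (col_mx (row_base B) 0).
pose R : 'M[F]_(a + (b + c), k) := col_mx 0 (col_mx 0 (row_base C)).
have sP : (P <= A)%MS by rewrite /P !col_mx_sub !sub0mx eq_row_base submx_refl.
have sQ : (Q <= B)%MS by rewrite /Q !col_mx_sub !sub0mx eq_row_base submx_refl.
have sR : (R <= C)%MS by rewrite /R !col_mx_sub !sub0mx eq_row_base submx_refl.
(* The four incidences are imposed one after the other; [rank_preim_cap] measures the dimension lost
   at each stage. *)
pose K1 := kermx ((P + Q + R) *m cokermx W).
pose K2 := (K1 :&: kermx ((P + Q) *m cokermx Z))%MS.
pose K3 := (K2 :&: kermx ((P + R) *m cokermx Y))%MS.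
pose K4 := (K3 :&: kermx ((Q + R) *m cokermx X))%MS.
have s21 : (K2 <= K1)%MS by apply: capmxSl.
have s31 : (K3 <= K1)%MS by apply: submx_trans s21; apply: capmxSl.
have K1W : (K1 *m (P + Q + R) <= W)%MS by rewrite -sub_kermx_mul_coker.
have sMl m (M : 'M[F]_(m, _)) (N D : 'M[F]_(_, k)) :
  (N <= D)%MS -> (M *m N <= D)%MS by apply: submx_trans (submxMl _ _).
exists (a + (b + c))%N, K4, P, Q, R; split.
- by rewrite !sMl.
- rewrite -!sub_kermx_mul_coker; split; last exact: capmxSr.
    by apply: submx_trans (capmxSl _ _) (submx_trans (capmxSl _ _) (capmxSr _ _)).
  by apply: submx_trans (capmxSl _ _) (capmxSr _ _).
- move=> v; rewrite -[v]hsubmxK -[rsubmx v]hsubmxK !mul_row_col !mulmx0.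
  rewrite !add0r !addr0.
  have fr D (u : 'rV[F]_(\rank D)) : u *m row_base (D : 'M[F]_k) = 0 -> u = 0.
    by move=> uD; apply: (row_free_inj (row_base_free D)); rewrite mul0mx.
  by move=> /fr-> /fr-> /fr->; rewrite !row_mx0.
have r1 := rank_preim_cap (1%:M : 'M[F]_(a + (b + c))) (P + Q + R) W.
have r2 := rank_preim_cap K1 (P + Q) Z.
have r3 := rank_preim_cap K2 (P + R) Y.
have r4 := rank_preim_cap K3 (Q + R) X.
(* Submodularity: [M + V] lies in both [D + V] and [E + V]. *)
have leK m (M : 'M[F]_(m, k)) (D E V : 'M[F]_k) :
    (M <= D)%MS -> (M <= E)%MS ->
    (\rank (M + V)%MS + \rank (D + E + V)%MS
      <= \rank (D + V)%MS + \rank (E + V)%MS)%N.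
  move=> sMD sME; rewrite -(mxrank_sum_cap (D + V)%MS) addnC leq_add //.
    by apply: mxrankS; sum_sub.
  apply: mxrankS; rewrite addsmx_sub !sub_capmx.
  by repeat (apply/andP; split); in_sum.
(* On [K1] the image of [P1 + P2] lies in [D1 + D2] and, being the total minus the [P3] part, also
   in [W + D3]. *)
have bnd m (M : 'M[F]_(m, _)) (P1 P2 P3 : 'M[F]_(_, k)) (D1 D2 D3 V : 'M[F]_k) :
    (M <= K1)%MS -> P + Q + R = P1 + P2 + P3 ->
    (P1 <= D1)%MS -> (P2 <= D2)%MS -> (P3 <= D3)%MS ->
    (\rank (M *m (P1 + P2) + V)%MS + \rank (D1 + D2 + (W + D3) + V)%MS
      <= \rank (D1 + D2 + V)%MS + \rank (W + D3 + V)%MS)%N.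
  move=> sMK eP s1 s2 s3; apply: leK.
    by rewrite mulmxDr; apply: addmx_sub; apply: sMl;
      [apply: submx_trans s1 (addsmxSl _ _) | apply: submx_trans s2 (addsmxSr _ _)].
  have -> : P1 + P2 = (P + Q + R) - P3 by rewrite eP addrK.
  rewrite mulmxBr; apply: addmx_sub.
    by apply: submx_trans (addsmxSl _ _); apply: submx_trans K1W; apply: submxMr.
  by rewrite eqmx_opp; apply: sMl; apply: submx_trans s3 (addsmxSr _ _).
have b2 := bnd _ K1 P Q R A B C Z (submx_refl _) erefl sP sQ sR.
have b3 := bnd _ K2 P R Q A C B Y s21 (addrAC _ _ _) sP sR sQ.
have eP : P + Q + R = Q + R + P by rewrite -addrA addrC.
have b4 := bnd _ K3 Q R P B C A X s31 eP sQ sR sP.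
have e2 : (\rank (A + B + C + W + Z)%MS <= \rank (A + B + (W + C) + Z)%MS)%N.
  by apply: mxrankS; sum_sub.
have e3 : (\rank (A + B + C + W + Y)%MS <= \rank (A + C + (W + B) + Y)%MS)%N.
  by apply: mxrankS; sum_sub.
have e4 : (\rank (A + B + C + W + X)%MS <= \rank (B + C + (W + A) + X)%MS)%N.
  by apply: mxrankS; sum_sub.
have e1 : (\rank (1%:M *m (P + Q + R) + W)%MS <= \rank (A + B + C + W)%MS)%N.
  rewrite mul1mx; apply/mxrankS/addsmxS => //.
  apply: addmx_sub; last exact: submx_trans sR (addsmxSr _ _).
  apply: submx_trans (addsmxSl _ _); apply: addmx_sub.
    exact: submx_trans sP (addsmxSl _ _).
  exact: submx_trans sQ (addsmxSr _ _).
have eK1 : \rank (1%:M :&: K1) = \rank K1.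
  by apply/eqmx_rank/eqmxP/capmx_idPr; apply: submx1.
rewrite -/K1 eK1 mxrank1 in r1; rewrite -/K2 in r2; rewrite -/K3 in r3.
rewrite -/K4 in r4; rewrite /a /b /c in r1.
move: (\rank K1) (\rank K2) (\rank K3) (\rank K4)
  (\rank (1%:M *m (P + Q + R) + W)) (\rank (K1 *m (P + Q) + Z))
  (\rank (K2 *m (P + R) + Y)) (\rank (K3 *m (Q + R) + X))
  r1 r2 r3 r4 b2 b3 b4 e1 e2 e3 e4 => *.
clear K1W sMl leK bnd eK1 eP sP sQ sR s21 s31 K4 K3 K2 K1 P Q R a b c; lia.
Qed.

Lemma rank_zero_of_sub m n (M : 'M[F]_(m, n)) :
  (forall v : 'rV_n, (v <= M)%MS -> v = 0) -> \rank M = 0%N.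
Proof.
move=> H; apply/eqP; rewrite mxrank_eq0; apply/eqP/row_matrixP => i.
by rewrite row0; apply: H; apply: row_sub.
Qed.

(** [K] is filtered by c, then b, then a. Halving (b + c) + (a + c) - (a + b) puts c in [X + Y + Z];
    where c = 0, b = b + c lies in [X]; where also b = 0, a = a + c lies in [Y]; what remains is
    zero. *)
Lemma triple_le_odd n (K : 'M[F]_n) (P Q R : 'M[F]_(n, k)) : (2 : F) != 0 ->
  (K *m P <= A)%MS -> (K *m Q <= B)%MS -> (K *m R <= C)%MS ->
  (K *m (P + Q) <= Z)%MS -> (K *m (P + R) <= Y)%MS -> (K *m (Q + R) <= X)%MS ->
  (forall v : 'rV_n, v *m P = 0 -> v *m Q = 0 -> v *m R = 0 -> v = 0) ->
  (\rank K <= \rank (C :&: (X + Y + Z)) + \rank (B :&: X) + \rank (A :&: Y))%N.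
Proof.
move=> nz2 KA KB KC KZ KY KX inj.
have h1 : (K *m R <= C :&: (X + Y + Z))%MS.
  rewrite sub_capmx KC /=.
  have -> : K *m R = 2^-1 *: (K *m (Q + R) + K *m (P + R) - K *m (P + Q)).
    rewrite -mulmxDr -mulmxBr scalemxAr; congr (_ *m _).
    rewrite (_ : _ - _ = 2 *: R) ?scalerA ?mulVf ?scale1r //.
    by rewrite scaler_nat; apply/matrixP => i j; rewrite !mxE; ring.
  apply: scalemx_sub; apply: addmx_sub; [apply: addmx_sub|].
  - apply: submx_trans KX _; by rewrite -addsmxA addsmxSl.
  - by apply: submx_trans KY _; rewrite addsmxC addsmxA addsmxSr.
  - by rewrite eqmx_opp; apply: submx_trans KZ (addsmxSr _ _).
pose K1 := (K :&: kermx R)%MS; pose K2 := (K1 :&: kermx Q)%MS.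
have K1K : (K1 <= K)%MS by apply: capmxSl.
have K1R : K1 *m R = 0 by apply/sub_kermxP; apply: capmxSr.
have h2 : (K1 *m Q <= B :&: X)%MS.
  rewrite sub_capmx (submx_trans (submxMr _ K1K) KB) /=.
  by rewrite -[_ *m Q]addr0 -K1R -mulmxDr (submx_trans (submxMr _ K1K) KX).
have K2K1 : (K2 <= K1)%MS by apply: capmxSl.
have K2R : K2 *m R = 0 by apply/sub_kermxP; apply: submx_trans K2K1 (capmxSr _ _).
have K2Q : K2 *m Q = 0 by apply/sub_kermxP; apply: capmxSr.
have K2K := submx_trans K2K1 K1K.
have h3 : (K2 *m P <= A :&: Y)%MS.
  rewrite sub_capmx (submx_trans (submxMr _ K2K) KA) /=.
  by rewrite -[_ *m P]addr0 -K2R -mulmxDr (submx_trans (submxMr _ K2K) KY).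
have h4 : \rank (K2 :&: kermx P) = 0%N.
  apply: rank_zero_of_sub => v; rewrite sub_capmx => /andP[vK2 /sub_kermxP vP].
  apply: inj => //; apply/sub_kermxP/(submx_trans vK2); exact/sub_kermxP.
rewrite (leq_trans (rank_mul_cap_ker h1)) // -addnA leq_add2l.
rewrite (leq_trans (rank_mul_cap_ker h2)) // leq_add2l.
by rewrite (leq_trans (rank_mul_cap_ker h3)) // h4 addn0.
Qed.

(** [K] is filtered by b + c, then a + c, then c. In characteristic 2, b + c = (a + c) + (a + b);
    where b = c, a + c = a + b lies in [Y] and [Z]; where also a = c, the triple is (c, c, c) with c
    in [B] and [C]. *)
Lemma triple_le_char2 n (K : 'M[F]_n) (P Q R : 'M[F]_(n, k)) : (2 : F) = 0 ->
  (K *m P <= A)%MS -> (K *m Q <= B)%MS -> (K *m R <= C)%MS ->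
  (K *m (P + Q) <= Z)%MS -> (K *m (P + R) <= Y)%MS -> (K *m (Q + R) <= X)%MS ->
  (forall v : 'rV_n, v *m P = 0 -> v *m Q = 0 -> v *m R = 0 -> v = 0) ->
  (\rank K <= \rank (X :&: (Y + Z)) + \rank (Y :&: Z) + \rank (B :&: C))%N.
Proof.
move=> z2 KA KB KC KZ KY KX inj.
have opp2 m (M : 'M[F]_(m, k)) : - M = M.
  apply/eqP; rewrite eq_sym -addr_eq0 -mulr2n -scaler_nat.
  by rewrite z2 scale0r.
have h1 : (K *m (Q + R) <= X :&: (Y + Z))%MS.
  rewrite sub_capmx KX /=.
  have -> : Q + R = (P + R) + (P + Q).
    by rewrite addrACA -{1}(opp2 _ P) addNr add0r addrC.
  by rewrite mulmxDr; apply: addmx_sub;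
    [apply: submx_trans KY (addsmxSl _ _) | apply: submx_trans KZ (addsmxSr _ _)].
pose K1 := (K :&: kermx (Q + R))%MS; pose K2 := (K1 :&: kermx (P + R))%MS.
have K1K : (K1 <= K)%MS by apply: capmxSl.
have K1QR : K1 *m Q = K1 *m R.
  apply/eqP; rewrite -[K1 *m R]opp2 -addr_eq0 -mulmxDr.
  by apply/eqP/sub_kermxP; apply: capmxSr.
have h2 : (K1 *m (P + R) <= Y :&: Z)%MS.
  rewrite sub_capmx (submx_trans (submxMr _ K1K) KY) /=.
  by rewrite mulmxDr -K1QR -mulmxDr (submx_trans (submxMr _ K1K) KZ).
have K2K1 : (K2 <= K1)%MS by apply: capmxSl.
have K2PR : K2 *m P = K2 *m R.
  apply/eqP; rewrite -[K2 *m R]opp2 -addr_eq0 -mulmxDr.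
  by apply/eqP/sub_kermxP; apply: capmxSr.
have K2QR : K2 *m Q = K2 *m R.
  by have /submxP[D ->] := K2K1; rewrite -!mulmxA K1QR.
have K2K := submx_trans K2K1 K1K.
have h3 : (K2 *m R <= B :&: C)%MS.
  rewrite sub_capmx (submx_trans (submxMr _ K2K) KC) andbT.
  by rewrite -K2QR (submx_trans (submxMr _ K2K) KB).
have h4 : \rank (K2 :&: kermx R) = 0%N.
  apply: rank_zero_of_sub => v; rewrite sub_capmx => /andP[/submxP[D ->]].
  move/sub_kermxP => DR.
  by apply: inj; rewrite -mulmxA ?K2PR ?K2QR mulmxA DR.
rewrite (leq_trans (rank_mul_cap_ker h1)) // -addnA leq_add2l.
rewrite (leq_trans (rank_mul_cap_ker h2)) // leq_add2l.
by rewrite (leq_trans (rank_mul_cap_ker h3)) // h4 addn0.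
Qed.
End CharacteristicInequalities.

(** * Linear forms on set functions and Shannon-type inequalities *)

Lemma lin_comb_limit_ge0 (R : realType) (I : finType) (c h : I -> R)
    (f : nat -> I -> R) :
  (forall i, 0 <= \sum_a c a * f i a) ->
  (forall a, ((fun i => f i a) @ \oo --> h a)%classic) ->
  0 <= \sum_a c a * h a.
Proof.
move=> f0 fh.
have cvf : (\sum_a c a * f i a @[i --> \oo] --> \sum_a c a * h a)%classic.
  apply: cvg_big => [|a _]; first exact: add_continuous.
  by apply: cvgMl_tmp; apply: fh.
by apply: (cvgr_to_ge cvf); apply: nearW.
Qed.

Lemma rank_polymatroid (R : realType) (X : finType) (F : fieldType) (k : nat)
    (U : X -> 'M[F]_k) :
  polymatroid (fun A => (\rank (spn U A))%:R : R).
Proof.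
split=> [|A|A B sAB|A B]; rewrite ?ler0n //.
- by rewrite spn0 mxrank0.
- by rewrite ler_nat mxrankS ?spnS.
rewrite -!natrD ler_nat -(mxrank_sum_cap (spn U A)) leq_add //.
  by rewrite (eqmx_rank (introT eqmxP (spnU _ _ _))).
by apply: mxrankS; rewrite sub_capmx !spnS ?finset.subsetIl ?finset.subsetIr.
Qed.

Section LinearForms.
Variables (R : realType) (X : finType).
Implicit Types (g : {set X} -> R).

(** A predicate with closure lemmas, so that the long defect expressions are recognised by their
    syntax and their coefficients are never written out. *)
Definition lin_form (E : ({set X} -> R) -> R) := exists c : {set X} -> R,
  forall g, E g = \sum_(A : {set X}) c A * g A.

Lemma lin_form_eval (A : {set X}) : lin_form (fun g => g A).
Proof.
exists (fun B => (B == A)%:R) => g; rewrite (bigD1 A) //= eqxx mul1r.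
by rewrite big1 ?addr0 // => B /negbTE->; rewrite mul0r.
Qed.

Lemma lin_formD (E1 E2 : ({set X} -> R) -> R) : lin_form E1 -> lin_form E2 ->
  lin_form (fun g => E1 g + E2 g).
Proof.
move=> [c1 H1] [c2 H2]; exists (fun A => c1 A + c2 A) => g.
by rewrite H1 H2 -big_split /=; apply: eq_bigr => A _; rewrite mulrDl.
Qed.

Lemma lin_formZ (a : R) (E : ({set X} -> R) -> R) :
  lin_form E -> lin_form (fun g => a * E g).
Proof.
move=> [c H]; exists (fun A => a * c A) => g.
by rewrite H mulr_sumr; apply: eq_bigr => A _; rewrite mulrA.
Qed.

Lemma lin_formB (E1 E2 : ({set X} -> R) -> R) : lin_form E1 -> lin_form E2 ->
  lin_form (fun g => E1 g - E2 g).
Proof.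
move=> H1 /(lin_formZ (-1)) H2; have [c H] := lin_formD H1 H2.
by exists c => g; rewrite -H mulN1r.
Qed.

(** Nonnegativity passes to conic combinations by linearity, and to limits because a finite linear
    combination is continuous. *)
Lemma lin_form_ge0_cc (E : ({set X} -> R) -> R) h : lin_form E ->
  (forall g, representable g -> 0 <= E g) -> cc_representable h -> 0 <= E h.
Proof.
move=> [c Ec] Epos [f [fcone fh]].
have Ef i : 0 <= E (f i).
  have [m [l [g [l0 grep fE]]]] := fcone i.
  have -> : E (f i) = \sum_(j < m) l j * E (g j).
    rewrite Ec; under [RHS]eq_bigr do rewrite Ec mulr_sumr.
    rewrite exchange_big /=; apply: eq_bigr => A _.
    by rewrite fE mulr_sumr; apply: eq_bigr => j _; rewrite mulrCA.
  by apply: sumr_ge0 => j _; rewrite mulr_ge0 ?Epos.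
rewrite Ec; apply: lin_comb_limit_ge0 fh => i; rewrite -Ec; exact: Ef.
Qed.

Definition cond_ent g (A B : {set X}) := g (A :|: B) - g B.
Definition mut_info g (A B : {set X}) := g A + g B - g (A :|: B).
Definition cond_mut_info g (A B C : {set X}) :=
  g (A :|: C) + g (B :|: C) - g (A :|: B :|: C) - g C.

(* Vanishes on a matroid when [A], [B] and the elements of [C] form a circuit. *)
Definition circuit_defect g (A B C : {set X}) :=
  mut_info g A C + cond_ent g A (B :|: C).

(* [A B C W P Q S] stand for u1, u2, u3, u1 + u2 + u3, u2 + u3, u1 + u3,
   u1 + u2. *)
Definition frame_defect g (A B C W P Q S : {set X}) :=
  cond_mut_info g (A :|: B) (W :|: C) S + cond_mut_info g (A :|: C) (W :|: B) Q
  + cond_mut_info g (B :|: C) (W :|: A) P + cond_ent g W (A :|: B :|: C).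

Definition fano_defect g (A B C W P Q S : {set X}) :=
  frame_defect g A B C W P Q S
  + (mut_info g C (P :|: Q :|: S) + mut_info g B P + mut_info g A Q).

Definition nonfano_defect g (A B C W P Q S : {set X}) :=
  frame_defect g A B C W P Q S
  + (mut_info g P (Q :|: S) + mut_info g Q S + mut_info g B C).

(* The weights count how often [g W] enters when [g T] is bounded by the ranks
   of the elements of a basis of [T], each of them being reached from [W] through
   circuits; [V] and [V'] stand for u3 + u4 and u3 + u5. *)
Definition fano_total g A B C W P Q S T :=
  3 * fano_defect g A B C W P Q S + circuit_defect g A W (B :|: C)
  + circuit_defect g B W (A :|: C) + circuit_defect g C W (A :|: B)
  + cond_ent g T (A :|: B :|: C).

Definition nonfano_total g A B C W P Q S D V D' V' T :=
  5 * nonfano_defect g A B C W P Q S + circuit_defect g A W (B :|: C)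
  + circuit_defect g B W (A :|: C) + 3 * circuit_defect g C W (A :|: B)
  + circuit_defect g D C V + circuit_defect g D' C V'
  + cond_ent g T (A :|: B :|: C :|: D :|: D').

Lemma lin_form_fano_total A B C W P Q S T :
  lin_form (fun g => fano_total g A B C W P Q S T).
Proof.
by repeat first [exact: lin_form_eval | apply: lin_formB | apply: lin_formD
  | apply: lin_formZ].
Qed.

Lemma lin_form_nonfano_total A B C W P Q S D V D' V' T :
  lin_form (fun g => nonfano_total g A B C W P Q S D V D' V' T).
Proof.
by repeat first [exact: lin_form_eval | apply: lin_formB | apply: lin_formD
  | apply: lin_formZ].
Qed.

Section Shannon.
Variables (g : {set X} -> R) (gP : polymatroid g).

Lemma cond_ent_ge0 A B : 0 <= cond_ent g A B.
Proof.
by case: gP => _ _ mono _; rewrite subr_ge0; apply/mono/finset.subsetUr.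
Qed.

Lemma cond_mut_info_ge0 A B C : 0 <= cond_mut_info g A B C.
Proof.
case: gP => _ _ mono sub; have := sub (A :|: C) (B :|: C).
have := mono C ((A :|: C) :&: (B :|: C)).
rewrite finset.subsetI !finset.subsetUr -finset.setUUl => /(_ isT).
by rewrite /cond_mut_info; lra.
Qed.

Lemma polymatroid_subadd A B : g (A :|: B) <= g A + g B.
Proof. by case: gP => _ pos _ /(_ A B); have := pos (A :&: B); lra. Qed.

Lemma mut_info_ge0 A B : 0 <= mut_info g A B.
Proof. by rewrite subr_ge0 polymatroid_subadd. Qed.

(** Rank is transported along a circuit: monotonicity discards the two larger unions, and
    subadditivity bounds [g (B :|: C) - g C] by [g B]. *)
Lemma le_circuit_defect A B C : g A <= g B + circuit_defect g A B C.
Proof.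
have [_ _ mono _] := gP; have := polymatroid_subadd B C.
have := mono (A :|: C) (A :|: (B :|: C)).
rewrite finset.setUS ?finset.subsetUr // => /(_ isT).
by rewrite /circuit_defect /mut_info /cond_ent; lra.
Qed.

Local Ltac defect_ge0 := repeat first
  [ exact: cond_mut_info_ge0 | exact: mut_info_ge0 | exact: cond_ent_ge0
  | exact: ler0n | apply: addr_ge0 | apply: mulr_ge0 ].

Lemma fano_total_ge0 A B C W P Q S T : 0 <= fano_total g A B C W P Q S T.
Proof. by defect_ge0. Qed.

Lemma nonfano_total_ge0 A B C W P Q S D V D' V' T :
  0 <= nonfano_total g A B C W P Q S D V D' V' T.
Proof. by defect_ge0. Qed.

Lemma le_fano_total A B C W P Q S T :
  g W <= fano_defect g A B C W P Q S -> g T <= fano_total g A B C W P Q S T.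
Proof.
move=> leW; have [_ _ mono _] := gP.
have := le_circuit_defect A W (B :|: C); have := le_circuit_defect B W (A :|: C).
have := le_circuit_defect C W (A :|: B); have := polymatroid_subadd A B.
have := polymatroid_subadd (A :|: B) C.
have := mono T (T :|: (A :|: B :|: C)); rewrite finset.subsetUl => /(_ isT).
rewrite /fano_total /cond_ent; lra.
Qed.

(** Each of [A], [B], [C] is bounded through [W], while [D] and [D'] are bounded through [C]. Hence
    [C] is reached three times and [W] five times. *)
Lemma le_nonfano_total A B C W P Q S D V D' V' T :
  g W <= nonfano_defect g A B C W P Q S ->
  g T <= nonfano_total g A B C W P Q S D V D' V' T.
Proof.
move=> leW; have [_ _ mono _] := gP.
have := le_circuit_defect A W (B :|: C); have := le_circuit_defect B W (A :|: C).
have := le_circuit_defect C W (A :|: B); have := le_circuit_defect D C V.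
have := le_circuit_defect D' C V'; have := polymatroid_subadd A B.
have := polymatroid_subadd (A :|: B) C.
have := polymatroid_subadd (A :|: B :|: C) D.
have := polymatroid_subadd (A :|: B :|: C :|: D) D'.
have := mono T (T :|: (A :|: B :|: C :|: D :|: D')).
rewrite finset.subsetUl => /(_ isT).
rewrite /nonfano_total /cond_ent; lra.
Qed.
End Shannon.
End LinearForms.

(** * Defect inequalities for subspaces, by characteristic *)

Section RankDefects.
Variables (R : realType) (I : finType) (F : fieldType) (k : nat).
Variable U : I -> 'M[F]_k.
Let g (A : {set I}) : R := (\rank (spn U A))%:R.

(** The bound of [triple_space] regrouped into conditional mutual informations; subadditivity on
    [A], [B], [C] turns the remaining terms into the conditional entropy of [W]. *)
Lemma rank_frame A B C W P Q S :
  exists (n : nat) (K : 'M[F]_n) (P1 P2 P3 : 'M[F]_(n, k)),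
  [/\ [/\ (K *m P1 <= spn U A)%MS, (K *m P2 <= spn U B)%MS &
          (K *m P3 <= spn U C)%MS],
      [/\ (K *m (P1 + P2) <= spn U S)%MS, (K *m (P1 + P3) <= spn U Q)%MS &
          (K *m (P2 + P3) <= spn U P)%MS],
      (forall v : 'rV_n, v *m P1 = 0 -> v *m P2 = 0 -> v *m P3 = 0 -> v = 0) &
      g W <= (\rank K)%:R + frame_defect g A B C W P Q S].
Proof.
have [n [K [P1 [P2 [P3 [HA HZ inj le]]]]]] := triple_space (spn U A) (spn U B)
  (spn U C) (spn U W) (spn U P) (spn U Q) (spn U S).
exists n, K, P1, P2, P3; split=> //.
have gU (A1 A2 : {set I}) M : (spn U A1 :=: M)%MS ->
    (spn U (A1 :|: A2) :=: M + spn U A2)%MS.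
  by move=> eA; apply: eqmx_trans (spnU _ _ _) (adds_eqmx eA (eqmx_refl _)).
have g3 (A1 A2 A3 : {set I}) :
    (\rank (spn U A1 + spn U A2 + spn U A3)%MS)%:R = g (A1 :|: A2 :|: A3).
  by congr _%:R; apply/esym/eqmx_rank/eqmxP/gU/spnU.
have g5 (A1 : {set I}) :
    (\rank (spn U A + spn U B + spn U C + spn U W + spn U A1)%MS)%:R
    = g (A :|: B :|: C :|: W :|: A1).
  by congr _%:R; apply/esym/eqmx_rank/eqmxP/gU/gU/gU/spnU.
have g4 : (\rank (spn U A + spn U B + spn U C + spn U W)%MS)%:R
    = g (A :|: B :|: C :|: W).
  by congr _%:R; apply/esym/eqmx_rank/eqmxP/gU/gU/spnU.
move: le; rewrite -(ler_nat R) !natrD !g3 !g5 !g4.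
rewrite -/(g A) -/(g B) -/(g C) -/(g W) -/(g P) -/(g Q) -/(g S).
have eS : A :|: B :|: (W :|: C) = A :|: B :|: C :|: W.
  by apply/setP => i; rewrite !inE; do !case: (_ \in _).
have eQ : A :|: C :|: (W :|: B) = A :|: B :|: C :|: W.
  by apply/setP => i; rewrite !inE; do !case: (_ \in _).
have eP : B :|: C :|: (W :|: A) = A :|: B :|: C :|: W.
  by apply/setP => i; rewrite !inE; do !case: (_ \in _).
rewrite /frame_defect /cond_mut_info /cond_ent eS eQ eP.
rewrite [W :|: (A :|: B :|: C)]finset.setUC.
have gP : polymatroid g by apply: rank_polymatroid.
have := polymatroid_subadd gP A B; have := polymatroid_subadd gP (A :|: B) C; lra.
Qed.

Lemma mut_info_rank A B : mut_info g A B = (\rank (spn U A :&: spn U B))%:R.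
Proof.
rewrite /mut_info /g -natrD -mxrank_sum_cap natrD.
by rewrite (eqmx_rank (introT eqmxP (spnU _ _ _))) addrAC subrr add0r.
Qed.

Lemma le_fano_defect A B C W P Q S : (2 : F) != 0 ->
  g W <= fano_defect g A B C W P Q S.
Proof.
move=> nz2; have [n [K [P1 [P2 [P3 [[HA HB HC] [HS HQ HP] inj le]]]]]] :=
  rank_frame A B C W P Q S.
rewrite (le_trans le) // addrC lerD2l !mut_info_rank -!natrD ler_nat.
rewrite (leq_trans (triple_le_odd nz2 HA HB HC HS HQ HP inj)) // !leq_add2r.
apply: mxrankS; apply: capmxS => //.
by rewrite (eqmxP (introT eqmxP (spnU _ _ _))) addsmxS // spnU.
Qed.

Lemma le_nonfano_defect A B C W P Q S : (2 : F) = 0 ->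
  g W <= nonfano_defect g A B C W P Q S.
Proof.
move=> z2; have [n [K [P1 [P2 [P3 [[HA HB HC] [HS HQ HP] inj le]]]]]] :=
  rank_frame A B C W P Q S.
rewrite (le_trans le) // addrC lerD2l !mut_info_rank -!natrD ler_nat.
rewrite (leq_trans (triple_le_char2 z2 HA HB HC HS HQ HP inj)) // !leq_add2r.
by apply: mxrankS; apply: capmxS => //; rewrite spnU.
Qed.
End RankDefects.

(** * Truncation of almost representable functions *)

Lemma cvg_minr (R : realType) (u v : nat -> R) (l m : R) :
  (u @ \oo --> l -> v @ \oo --> m ->
   (fun i => Num.min (u i) (v i)) @ \oo --> Num.min l m)%classic.
Proof.
move=> ul vm; rewrite minr_absE.
under eq_cvg do rewrite minr_absE.
apply: cvgMr_tmp; apply: cvgB; first exact: cvgD.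
by apply: cvg_norm; apply: cvgB.
Qed.

(** Supplies rational truncation levels approaching [t]; the denominators start at 1. *)
Lemma cvg_truncn_ratio (R : realType) (t : R) : 0 <= t ->
  ((Num.truncn (t * i.+1%:R))%:R / i.+1%:R @[i --> \oo] --> t)%classic.
Proof.
move=> t0; have i0 i : 0 < i.+1%:R :> R by rewrite ltr0Sn.
apply: (@squeeze_cvgr _ _ _ _ (fun i => t - i.+1%:R^-1) (fun=> t)).
- apply: nearW => i; have ti : 0 <= t * i.+1%:R by rewrite mulr_ge0.
  rewrite ler_pdivrMr // ler_pdivlMr // mulrBl mulVf ?gt_eqF //.
  by have /andP[] := truncn_itv ti; rewrite -natr1; lra.
- rewrite -[X in (_ --> X)%classic]subr0; apply: cvgB; first exact: cvg_cst.
  exact: cvg_harmonic.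
- exact: cvg_cst.
Qed.

Section Truncation.
Variables (R : realType) (n : nat) (c : {set 'I_n} -> R).
Hypothesis Hc : lin_rank_ineq c.

Lemma lin_rank_ineq_minn (F : finFieldType) (k : nat) (U : 'I_n -> 'M[F]_k)
    (N r : nat) :
  0 <= \sum_a c a * (minn (N * \rank (spn U a)) r)%:R.
Proof.
have [k' [U' rU']] := rank_fun_muln U N.
have [F' [V rV]] := rank_fun_truncate U' r.
by under eq_bigr do rewrite -rU' -rV; apply: Hc.
Qed.

Lemma lin_rank_ineq_min (F : finFieldType) (k : nat) (U : 'I_n -> 'M[F]_k)
    (t : R) : 0 <= t -> 0 <= \sum_a c a * Num.min (\rank (spn U a))%:R t.
Proof.
move=> t0; apply: (lin_comb_limit_ge0 (f := fun i a => Num.min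
  (\rank (spn U a))%:R ((Num.truncn (t * i.+1%:R))%:R / i.+1%:R))).
  move=> i; have i0 : 0 < i.+1%:R :> R by rewrite ltr0Sn.
  (* Factoring out [i.+1%:R^-1] clears the denominator of the level and leaves an integral
     truncation of a multiple of the rank. *)
  set r := Num.truncn _; rewrite (_ : \sum_a _ =
    i.+1%:R^-1 * \sum_a c a * (minn (i.+1 * \rank (spn U a)) r)%:R).
    by apply: mulr_ge0; [rewrite invr_ge0 ltW | exact: lin_rank_ineq_minn].
  rewrite mulr_sumr; apply: eq_bigr => a _; rewrite mulrCA; congr (_ * _).
  rewrite natr_min minr_pMr ?invr_ge0 ?(ltW i0) // natrM mulKf ?gt_eqF //.
  by rewrite [in RHS]mulrC.
by move=> a; apply: cvg_minr; [exact: cvg_cst | exact: cvg_truncn_ratio].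
Qed.

Lemma almost_representable_min (h : {set 'I_n} -> R) (t : R) :
  almost_representable h -> 0 <= t -> 0 <= \sum_a c a * Num.min (h a) t.
Proof.
move=> [g [d [grep d0 gh]]] t0.
apply: (lin_comb_limit_ge0 (f := fun i a => Num.min (d i * g i a) t)); last first.
  by move=> a; apply: cvg_minr; [exact: gh | exact: cvg_cst].
move=> i; have [F [k [U gE]]] := grep i; have di := d0 i.
(* The scalar moves out of the minimum, rescaling the level to [t / d i]. *)
rewrite (_ : \sum_a _ =
    d i * \sum_a c a * Num.min (\rank (spn U a))%:R (t / d i)).
  apply: mulr_ge0; first exact: ltW.
  by apply: lin_rank_ineq_min; rewrite divr_ge0 // ltW.
rewrite mulr_sumr; apply: eq_bigr => a _; rewrite mulrCA; congr (_ * _).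
by rewrite minr_pMr ?(ltW di) // gE [d i * (t / _)]mulrC divfK ?gt_eqF.
Qed.
End Truncation.

(** * Pulling set functions back along unions *)

Lemma spn_bigcup (F : fieldType) (I X : finType) (k : nat) (U : X -> 'M[F]_k)
    (V : I -> {set X}) (a : {set I}) :
  (spn (fun i => spn U (V i)) a :=: spn U (\bigcup_(i in a) V i))%MS.
Proof.
apply/eqmxP/andP; split; apply/sumsmx_subP => i ia.
  by apply: spnS; apply: (finset.bigcup_sup i).
have /bigcupP[j ja iVj] := ia.
by apply: (sumsmx_sup j) => //; apply: (sumsmx_sup i).
Qed.

Lemma representable_bigcup (R : realType) (I X : finType) (V : I -> {set X})
    (g : {set X} -> R) :
  representable g -> representable (fun a : {set I} => g (\bigcup_(i in a) V i)).
Proof.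
move=> [F [k [U gE]]]; exists F, k, (fun i => spn U (V i)) => a.
by rewrite gE; congr _%:R; apply/esym/eqmx_rank/eqmxP/spn_bigcup.
Qed.

Lemma cc_representable_bigcup (R : realType) (I X : finType) (V : I -> {set X})
    (h : {set X} -> R) : cc_representable h ->
  cc_representable (fun a : {set I} => h (\bigcup_(i in a) V i)).
Proof.
move=> [f [fcone fh]]; exists (fun i (a : {set I}) => f i (\bigcup_(j in a) V j)).
split=> [i|a]; last exact: fh.
have [m [l [g [l0 grep fE]]]] := fcone i.
exists m, l, (fun j (a : {set I}) => g j (\bigcup_(i in a) V i)); split=> // j.
exact: representable_bigcup.
Qed.

(** Pulling [h] back along [V] moves it to a ground set of size [n], where cc-representability gives
    almost representability. The sets [V i] may fail to cover [X], so the truncation is at an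
    arbitrary level, here [h [set: X] - eps]. *)
Lemma truncate_satisfies (R : realType) (n : nat) (c : {set 'I_n} -> R) :
  (forall h : {set 'I_n} -> R, cc_representable h -> almost_representable h) ->
  lin_rank_ineq c ->
  forall (X : finType) (h : {set X} -> R) (eps : R), cc_representable h ->
  eps <= h [set: X] -> satisfies_ineq c (truncate h eps).
Proof.
move=> Hn Hc X h eps hcc le_eps V; apply: (almost_representable_min Hc).
  exact/Hn/cc_representable_bigcup.
by rewrite subr_ge0.
Qed.

(** * The Fano and non-Fano configurations *)

Section Tightness.
Variables (R : realType) (I : finType) (F : fieldType) (k : nat).
Variable v : I -> 'rV[F]_k.
Let U i := <<v i>>%MS.
Variable g : {set I} -> R.
Hypothesis gE : forall A, g A = (\rank (spn U A))%:R.

Lemma mem_spn i (A : {set I}) : i \in A -> (v i <= spn U A)%MS.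
Proof. by move=> iA; apply: (sumsmx_sup i); rewrite ?genmxE. Qed.

Lemma spn_subP (A : {set I}) m (M : 'M[F]_(m, k)) :
  reflect (forall i, i \in A -> (v i <= M)%MS) (spn U A <= M)%MS.
Proof.
by apply: (iffP sumsmx_subP) => H i /H; rewrite genmxE.
Qed.

(** Upper bounds on ranks in the two configurations come from listing generators; lower bounds come
    from [rank_mono_generators] applied to a set of known rank. *)
Lemma rank_le_generators (A : {set I}) (s : seq I) :
  (forall i, i \in A -> (v i <= spn U [set j in s])%MS) -> g A <= (size s)%:R.
Proof.
move=> sA; rewrite gE ler_nat.
apply: leq_trans (_ : \rank (spn U [set j in s]) <= _)%N.
  by apply: mxrankS; apply/spn_subP.
elim: s {sA} => [|j s IH]; first by rewrite finset.set_nil spn0 mxrank0.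
rewrite finset.set_cons (eqmx_rank (introT eqmxP (spnU _ _ _))).
rewrite (leq_trans (mxrank_adds_leqif _ _)) //= -add1n leq_add //.
by rewrite spn1 mxrank_gen rank_leq_row.
Qed.

Lemma rank_mono_generators (A B : {set I}) :
  (forall i, i \in A -> (v i <= spn U B)%MS) -> g A <= g B.
Proof. by move=> /spn_subP sAB; rewrite !gE ler_nat mxrankS. Qed.

Lemma rank_subadd (A B : {set I}) : g (A :|: B) <= g A + g B.
Proof.
have -> : g = fun A => (\rank (spn U A))%:R by apply/funext.
exact: polymatroid_subadd (rank_polymatroid _ _) _ _.
Qed.

Lemma rank_single i : g [set i] <= 1.
Proof.
apply: (rank_le_generators (s := [:: i])) => j; rewrite !inE => /eqP->.
by apply: mem_spn; rewrite !inE.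
Qed.

Lemma rank_single_ge1 i j l :
  3 <= g ([set i] :|: [set j] :|: [set l]) -> 1 <= g [set i].
Proof.
move: (rank_subadd ([set i] :|: [set j]) [set l]) (rank_subadd [set i] [set j]).
by move: (rank_single j) (rank_single l); lra.
Qed.

Lemma rank_pair_ge2 i j l :
  3 <= g ([set i] :|: [set j] :|: [set l]) -> 2 <= g ([set i] :|: [set j]).
Proof.
by move: (rank_subadd ([set i] :|: [set j]) [set l]) (rank_single l); lra.
Qed.

Lemma rank_pair_ge2_of5 i j a b l :
  5 <= g ([set i] :|: [set j] :|: [set a] :|: [set b] :|: [set l]) ->
  2 <= g ([set i] :|: [set j]).
Proof.
move: (rank_subadd ([set i] :|: [set j]) [set a]).
move: (rank_subadd ([set i] :|: [set j] :|: [set a]) [set b]).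
move: (rank_subadd ([set i] :|: [set j] :|: [set a] :|: [set b]) [set l]).
by move: (rank_single l) (rank_single a) (rank_single b); lra.
Qed.

Lemma rank_triple_ge3 a b c d e :
  5 <= g ([set a] :|: [set b] :|: [set c] :|: [set d] :|: [set e]) ->
  3 <= g ([set a] :|: [set b] :|: [set c]).
Proof.
move: (rank_subadd ([set a] :|: [set b] :|: [set c] :|: [set d]) [set e]).
move: (rank_subadd ([set a] :|: [set b] :|: [set c]) [set d]).
by move: (rank_single d) (rank_single e); lra.
Qed.

Lemma cond_mut_info_le0 (A B C : {set I}) : g (A :|: C) <= 2 ->
  g (B :|: C) <= 2 -> 3 <= g (A :|: B :|: C) -> 1 <= g C ->
  cond_mut_info g A B C <= 0.
Proof. by rewrite /cond_mut_info; lra. Qed.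

Lemma cond_ent_le0 n (A B : {set I}) : g (A :|: B) <= n -> n <= g B ->
  cond_ent g A B <= 0.
Proof. by rewrite /cond_ent; lra. Qed.

Lemma mut_info_le0 n m (A B : {set I}) : g A <= n -> g B <= m ->
  n + m <= g (A :|: B) -> mut_info g A B <= 0.
Proof. by rewrite /mut_info; lra. Qed.

Lemma addr_le0 (p q : R) : p <= 0 -> q <= 0 -> p + q <= 0.
Proof. lra. Qed.

Lemma add12_le3 : 1 + 2 <= 3 :> R.
Proof. lra. Qed.

(** With [line_right] and [line_left]: on a three-point line any two vectors span the third. *)
Lemma line_sum t p q (M : 'M[F]_k) : v t = v p + v q ->
  (v p <= M)%MS -> (v q <= M)%MS -> (v t <= M)%MS.
Proof. by move->; apply: addmx_sub. Qed.

Lemma line_right t p q (M : 'M[F]_k) : v t = v p + v q ->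
  (v t <= M)%MS -> (v p <= M)%MS -> (v q <= M)%MS.
Proof.
move=> e tM pM; have -> : v q = v t - v p by rewrite e addrC addKr.
by rewrite addmx_sub // eqmx_opp.
Qed.

Lemma line_left t p q (M : 'M[F]_k) : v t = v p + v q ->
  (v t <= M)%MS -> (v q <= M)%MS -> (v p <= M)%MS.
Proof. by rewrite addrC; apply: line_right. Qed.

Local Ltac in_span := by apply: mem_spn; rewrite !inE !eqxx ?orbT.
Local Ltac by_line e tac := first
  [ apply: (line_sum e); tac | apply: (line_right e); tac
  | apply: (line_left e); tac ].

Lemma circuit3_tight c d e : v e = v c + v d ->
  2 <= g ([set d] :|: [set e]) -> 2 <= g ([set c] :|: [set e]) ->
  circuit_defect g [set d] [set c] [set e] <= 0.
Proof.
move=> ve de ce.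
apply: addr_le0.
  exact: (mut_info_le0 (rank_single d) (rank_single e)).
apply: (cond_ent_le0 (n := 2)) => //.
apply: (rank_le_generators (s := [:: c; d])) => i; rewrite !inE.
by move=> /or3P[] /eqP->; first [in_span | by_line ve ltac:(in_span)].
Qed.

Section Frame.
Variables (a b c w x y z : I).
Hypotheses (vz : v z = v a + v b) (vy : v y = v a + v c) (vx : v x = v b + v c).
Hypothesis vw : v w = v z + v c.

Let vwy : v w = v y + v b.
Proof. by rewrite vw vz vy addrAC. Qed.
Let vwx : v w = v x + v a.
Proof. by rewrite vw vz vx addrC addrA addrC -addrA addrC. Qed.

Local Notation A := [set a].
Local Notation B := [set b].
Local Notation C := [set c].
Local Notation W := [set w].
Local Notation X := [set x].
Local Notation Y := [set y].
Local Notation Z := [set z].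

(** Span membership is searched along lines, nested at most two deep in [spans]. *)
Local Ltac step tac := first
  [ in_span | by_line vz tac | by_line vy tac | by_line vx tac
  | by_line vw tac | by_line vwy tac | by_line vwx tac ].
Local Ltac spans := step ltac:(step ltac:(in_span)).
Local Ltac upper s := apply: (rank_le_generators (s := s)) => i;
  rewrite !inE -?orbA;
  repeat (case/orP => [/eqP->|]; first by spans); move/eqP->; spans.

Hypothesis abc3 : 3 <= g (A :|: B :|: C).

Local Ltac lower := apply: (le_trans abc3); apply: rank_mono_generators => i;
  rewrite !inE -?orbA;
  repeat (case/orP => [/eqP->|]; first by spans); move/eqP->; spans.

(** In the projective plane on a, b, c, the lines ab and cw meet only in z, ac and bw only in y, and
    bc and aw only in x. Each conditional mutual information is thus at most 2 + 2 - 3 - 1. *)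
Lemma frame_tight : frame_defect g A B C W X Y Z <= 0.
Proof.
apply: addr_le0; first (apply: addr_le0; first apply: addr_le0).
- apply: cond_mut_info_le0; [upper [:: a; b] | upper [:: c; z] | lower |].
  by apply: (@rank_single_ge1 z a c); lower.
- apply: cond_mut_info_le0; [upper [:: a; c] | upper [:: b; y] | lower |].
  by apply: (@rank_single_ge1 y a b); lower.
- apply: cond_mut_info_le0; [upper [:: b; c] | upper [:: a; x] | lower |].
  by apply: (@rank_single_ge1 x a b); lower.
by apply: (cond_ent_le0 (n := 3)); [upper [:: a; b; c] | lower].
Qed.

Lemma circuit_a_tight : circuit_defect g A W (B :|: C) <= 0.
Proof.
apply: addr_le0.
  apply: (mut_info_le0 (n := 1) (m := 2)); [exact: rank_single|upper [:: b; c]|].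
  by apply: (le_trans add12_le3); lower.
by apply: (cond_ent_le0 (n := 3)); [upper [:: a; b; c] | lower].
Qed.

Lemma circuit_b_tight : circuit_defect g B W (A :|: C) <= 0.
Proof.
apply: addr_le0.
  apply: (mut_info_le0 (n := 1) (m := 2)); [exact: rank_single|upper [:: a; c]|].
  by apply: (le_trans add12_le3); lower.
by apply: (cond_ent_le0 (n := 3)); [upper [:: a; b; c] | lower].
Qed.

Lemma circuit_c_tight : circuit_defect g C W (A :|: B) <= 0.
Proof.
apply: addr_le0.
  apply: (mut_info_le0 (n := 1) (m := 2)); [exact: rank_single|upper [:: a; b]|].
  by apply: (le_trans add12_le3); lower.
by apply: (cond_ent_le0 (n := 3)); [upper [:: a; b; c] | lower].
Qed.

(** In characteristic 2 the points x, y, z are collinear, and c is off their line. *)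
Lemma fano_tight : (2 : F) = 0 -> fano_defect g A B C W X Y Z <= 0.
Proof.
move=> z2; have vxyz : v x = v y + v z.
  by rewrite vx vy vz addrACA -mulr2n -scaler_nat z2 scale0r add0r addrC.
apply: addr_le0; first exact: frame_tight.
apply: addr_le0; first apply: addr_le0.
- apply: (mut_info_le0 (n := 1) (m := 2)); first exact: rank_single.
    apply: (rank_le_generators (s := [:: y; z])) => i; rewrite !inE -orbA.
    by move=> /or3P[] /eqP->; first [in_span | by_line vxyz ltac:(in_span)].
  by apply: (le_trans add12_le3); lower.
- apply: (mut_info_le0 (rank_single b) (rank_single x)).
  by apply: (@rank_pair_ge2 b x a); lower.
- apply: (mut_info_le0 (rank_single a) (rank_single y)).
  by apply: (@rank_pair_ge2 a y b); lower.
Qed.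

(** When 2 is invertible, x, y, z are independent: half of x + y - z is c, and then a and b are
    recovered. *)
Lemma nonfano_tight : (2 : F) != 0 -> nonfano_defect g A B C W X Y Z <= 0.
Proof.
move=> nz2.
have pqs : 3 <= g (X :|: (Y :|: Z)).
  set S := _ :|: _.
  have sx : (v x <= spn U S)%MS by in_span.
  have sy : (v y <= spn U S)%MS by in_span.
  have sz : (v z <= spn U S)%MS by in_span.
  have sc : (v c <= spn U S)%MS.
    have -> : v c = 2^-1 *: (v x + v y - v z).
      rewrite (_ : _ - _ = 2 *: v c) ?scalerA ?mulVf ?scale1r //.
      rewrite vx vy vz scaler_nat mulr2n.
      apply/(canLR (addrK _)).
      by rewrite addrACA [v b + v a]addrC [RHS]addrC.
    by rewrite scalemx_sub // !addmx_sub // eqmx_opp.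
  have sa := line_left vy sy sc; have sb := line_left vx sx sc.
  apply: (le_trans abc3); apply: rank_mono_generators => i; rewrite !inE -orbA.
  by move=> /or3P[] /eqP->.
apply: addr_le0; first exact: frame_tight.
apply: addr_le0; first apply: addr_le0.
- apply: (mut_info_le0 (n := 1) (m := 2)); first exact: rank_single.
    by upper [:: y; z].
  exact: le_trans add12_le3 pqs.
- apply: (mut_info_le0 (rank_single y) (rank_single z)).
  by apply: (@rank_pair_ge2 y z x); rewrite finset.setUC.
- apply: (mut_info_le0 (rank_single b) (rank_single c)).
  by apply: (@rank_pair_ge2 b c a); lower.
Qed.

Lemma fano_total_tight T : (2 : F) = 0 -> (forall S, g S <= 3) ->
  fano_total g A B C W X Y Z T <= 0.
Proof.
move=> z2 le3; have T0 := cond_ent_le0 (le3 (T :|: (A :|: B :|: C))) abc3.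
by repeat first [ exact: T0 | exact: fano_tight | exact: circuit_a_tight
  | exact: circuit_b_tight | exact: circuit_c_tight | exact: ler0n
  | apply: addr_le0 | apply: mulr_ge0_le0 ].
Qed.

Lemma nonfano_total_tight d p e q T : (2 : F) != 0 -> (forall S, g S <= 5) ->
  v p = v c + v d -> v q = v c + v e ->
  5 <= g (A :|: B :|: C :|: [set d] :|: [set e]) ->
  nonfano_total g A B C W X Y Z [set d] [set p] [set e] [set q] T <= 0.
Proof.
move=> nz2 le5 vp vq ge5.
have T0 := cond_ent_le0 (le5 (T :|: (A :|: B :|: C :|: [set d] :|: [set e]))) ge5.
have span5 S : (v a <= spn U S)%MS -> (v b <= spn U S)%MS -> (v c <= spn U S)%MS ->
    (v d <= spn U S)%MS -> (v e <= spn U S)%MS -> 5 <= g S.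
  move=> sa sb sc sd se; apply: (le_trans ge5); apply: rank_mono_generators => i.
  by rewrite !inE -!orbA; do 4!(case/orP=> [/eqP->//|]); move/eqP->.
have dp : circuit_defect g [set d] C [set p] <= 0.
  apply: circuit3_tight => //; apply: (@rank_pair_ge2_of5 _ _ a b e); apply: span5;
    first [in_span | by_line vp ltac:(in_span)].
have eq : circuit_defect g [set e] C [set q] <= 0.
  apply: circuit3_tight => //; apply: (@rank_pair_ge2_of5 _ _ a b d); apply: span5;
    first [in_span | by_line vq ltac:(in_span)].
by repeat first [ exact: T0 | exact: nonfano_tight | exact: circuit_a_tight
  | exact: circuit_b_tight | exact: circuit_c_tight | exact: dp | exact: eq
  | exact: ler0n | apply: addr_le0 | apply: mulr_ge0_le0 ].
Qed.
End Frame.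
End Tightness.

Section Imset.
Variables (R : realType) (X Y : finType) (f : X -> Y) (g : {set Y} -> R).

(** Used to evaluate the form of the disjoint union inside one component. *)
Lemma fano_total_imset (A B C W P Q S T : {set X}) :
  fano_total g (f @: A) (f @: B) (f @: C) (f @: W) (f @: P) (f @: Q) (f @: S)
    (f @: T) = fano_total (fun A : {set X} => g (f @: A)) A B C W P Q S T.
Proof. by rewrite /fano_total /fano_defect /frame_defect /circuit_defect
 /cond_mut_info /mut_info /cond_ent !imsetU. Qed.

Lemma nonfano_total_imset (A B C W P Q S D V D' V' T : {set X}) :
  nonfano_total g (f @: A) (f @: B) (f @: C) (f @: W) (f @: P) (f @: Q) (f @: S)
    (f @: D) (f @: V) (f @: D') (f @: V') (f @: T)
  = nonfano_total (fun A : {set X} => g (f @: A)) A B C W P Q S D V D' V' T.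
Proof. by rewrite /nonfano_total /nonfano_defect /frame_defect /circuit_defect
 /cond_mut_info /mut_info /cond_ent !imsetU. Qed.
End Imset.

(** * The polymatroid Phi and its truncation *)

Lemma separation_ge0 (R : realType) (X : finType) (g : {set X} -> R)
    A B C W P Q S T A' B' C' W' P' Q' S' D V D' V' T' :
  representable g ->
  0 <= g [set: X] - g T - g T' + fano_total g A B C W P Q S T
       + nonfano_total g A' B' C' W' P' Q' S' D V D' V' T'.
Proof.
move=> [F [k [U gE]]].
have {gE} -> : g = fun A => (\rank (spn U A))%:R by apply/funext => ?; apply: gE.
have gP := rank_polymatroid R U; have [_ _ mono _] := gP.
have := mono T [set: X]; have := mono T' [set: X]; rewrite !finset.subsetT.
move=> /(_ isT) T'X /(_ isT) TX.
have [z2|nz2] := eqVneq (2 : F) 0.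
  have := fano_total_ge0 gP A B C W P Q S T.
  have := le_nonfano_total gP D V D' V' T'
    (le_nonfano_defect R U A' B' C' W' P' Q' S' z2).
  lra.
have := nonfano_total_ge0 gP A' B' C' W' P' Q' S' D V D' V' T'.
have := le_fano_total gP T (le_fano_defect R U A B C W P Q S nz2).
lra.
Qed.

Lemma lin_form_separation (R : realType) (X : finType)
    (A B C W P Q S T A' B' C' W' P' Q' S' D V D' V' T' : {set X}) :
  lin_form (fun g : {set X} -> R =>
    g [set: X] - g T - g T' + fano_total g A B C W P Q S T
       + nonfano_total g A' B' C' W' P' Q' S' D V D' V' T').
Proof.
apply: lin_formD (lin_form_nonfano_total _ _ _ _ _ _ _ _ _ _ _ _ _).
apply: lin_formD (lin_form_fano_total _ _ _ _ _ _ _ _ _).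
by apply: lin_formB; [apply: lin_formB|]; apply: lin_form_eval.
Qed.

(** Memberships are counted in [nat], which makes the supports of [p] and [q] disjoint; the identity
    then holds in every characteristic. *)
Lemma elt_vecD (F : fieldType) (m k : nat) (supp : nat -> seq nat)
    (u : 'M[F]_(m, k)) (t p q : nat) :
  (forall j : 'I_m, (nat_of_ord j \in supp t : nat) =
     ((nat_of_ord j \in supp p) + (nat_of_ord j \in supp q))%N) ->
  elt_vec supp u t = elt_vec supp u p + elt_vec supp u q.
Proof.
move=> tpq; rewrite /elt_vec !(big_mkcond (fun j : 'I_m => _ \in _)) -big_split.
apply: eq_bigr => j _; move: (tpq j).
by case: (_ \in supp t); case: (_ \in supp p); case: (_ \in supp q) => //= _;
  rewrite ?addr0 ?add0r.
Qed.

Section PhiPart.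
Variables (F : fieldType) (m k N : nat) (supp : nat -> seq nat).
Variable u : 'M[F]_(m, k).

Lemma Phi_part_le (A : {set 'I_N}) : (Phi_part supp u A <= m)%N.
Proof.
rewrite (leq_trans _ (rank_leq_row u)) //; apply: mxrankS.
apply/sumsmx_subP => e _; rewrite genmxE; apply: summx_sub => j _.
exact: row_sub.
Qed.

Lemma Phi_part_mono (A B : {set 'I_N}) : A \subset B ->
  (Phi_part supp u A <= Phi_part supp u B)%N.
Proof. by move=> sAB; apply: mxrankS; apply: spnS. Qed.

Lemma Phi_part0 : Phi_part supp u (finset.set0 : {set 'I_N}) = 0%N.
Proof. by rewrite /Phi_part big_set0 mxrank0. Qed.

Lemma Phi_part_ge (A : {set 'I_N}) : row_free u ->
  (forall j : 'I_m, exists2 e : 'I_N, e \in A & supp e = [:: nat_of_ord j]) ->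
  (m <= Phi_part supp u A)%N.
Proof.
move=> /eqP ru sA; rewrite -{1}ru; apply: mxrankS; apply/row_subP => j.
have [e eA se] := sA j; apply: (sumsmx_sup e) => //; rewrite genmxE /elt_vec se.
by rewrite (big_pred1 j) // => i; rewrite inE.
Qed.
End PhiPart.

Section Phi.
Variables (R : realType) (F1 F2 : finFieldType) (k1 k2 : nat).
Variables (u1 : 'M[F1]_(3, k1)) (u2 : 'M[F2]_(5, k2)).
Local Notation X := ('I_7 + 'I_13)%type.

Lemma representable_Phi1 :
  representable (fun A : {set X} => (Phi1 u1 [set x | inl x \in A])%:R : R).
Proof.
(* Elements of the other component become loops. *)
exists F1, k1, (fun x : X => if x is inl e then <<elt_vec supp1 u1 e>>%MS else 0).
move=> A; congr _%:R; apply/eqmx_rank/andP; split; apply/sumsmx_subP.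
  by move=> e; rewrite inE => eA; apply: (sumsmx_sup (inl e)).
by case=> [e eA|e _]; rewrite ?sub0mx //; apply: (sumsmx_sup e); rewrite ?inE.
Qed.

Lemma representable_Phi2 :
  representable (fun A : {set X} => (Phi2 u2 [set x | inr x \in A])%:R : R).
Proof.
exists F2, k2, (fun x : X => if x is inr e then <<elt_vec supp2 u2 e>>%MS else 0).
move=> A; congr _%:R; apply/eqmx_rank/andP; split; apply/sumsmx_subP.
  by move=> e; rewrite inE => eA; apply: (sumsmx_sup (inr e)).
by case=> [e _|e eA]; rewrite ?sub0mx //; apply: (sumsmx_sup e); rewrite ?inE.
Qed.

(** The summands are representable over possibly different fields, but the cone still contains their
    sum. *)
Lemma cc_representable_Phi : cc_representable (Phi R u1 u2).
Proof.
exists (fun=> Phi R u1 u2); split=> [_|A]; last exact: cvg_cst.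
exists 2%N, (fun=> 1), (fun (j : 'I_2) (A : {set X}) =>
  if j == ord0 then (Phi1 u1 [set x | inl x \in A])%:R
  else (Phi2 u2 [set x | inr x \in A])%:R); split=> // [j|A].
  by case: eqP => _; [exact: representable_Phi1 | exact: representable_Phi2].
by rewrite !big_ord_recl big_ord0 /= !mul1r addr0.
Qed.

Lemma Phi_setT : Phi R u1 u2 [set: X] =
  (Phi1 u1 [set: 'I_7])%:R + (Phi2 u2 [set: 'I_13])%:R.
Proof.
by congr (_%:R + _%:R); [congr Phi1 | congr Phi2]; apply/setP => x; rewrite !inE.
Qed.

Variable eps : R.
Hypothesis eps_le1 : eps <= (Phi1 u1 [set: 'I_7])%:R.
Hypothesis eps_le2 : eps <= (Phi2 u2 [set: 'I_13])%:R.

(** A subset of the first component falls short of the total by at least the rank of the second,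
    hence by at least [eps], so the truncation does not reach it. *)
Lemma Phi_eps_inl (S : {set 'I_7}) :
  Phi_eps u1 u2 eps (inl @: S) = (Phi1 u1 S)%:R.
Proof.
have PS : Phi R u1 u2 (inl @: S) = (Phi1 u1 S)%:R.
  rewrite /Phi (_ : [set x | _] = S); last first.
    by apply/setP => x; rewrite inE mem_imset // => ? ? [].
  rewrite (_ : [set x | _] = finset.set0) /Phi2 ?Phi_part0 ?addr0 //.
  by apply/setP => x; rewrite !inE; apply/imsetP => -[].
rewrite /Phi_eps /truncate PS Phi_setT; apply/min_idPl.
rewrite (le_trans (_ : _ <= (Phi1 u1 [set: 'I_7])%:R)) //.
  by rewrite ler_nat; apply/Phi_part_mono/finset.subsetT.
by rewrite -addrA lerDl subr_ge0.
Qed.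

Lemma Phi_eps_inr (S : {set 'I_13}) :
  Phi_eps u1 u2 eps (inr @: S) = (Phi2 u2 S)%:R.
Proof.
have PS : Phi R u1 u2 (inr @: S) = (Phi2 u2 S)%:R.
  rewrite /Phi (_ : [set x | inr x \in _] = S); last first.
    by apply/setP => x; rewrite inE mem_imset // => ? ? [].
  rewrite (_ : [set x | _] = finset.set0) /Phi1 ?Phi_part0 ?add0r //.
  by apply/setP => x; rewrite !inE; apply/imsetP => -[].
rewrite /Phi_eps /truncate PS Phi_setT; apply/min_idPl.
rewrite (le_trans (_ : _ <= (Phi2 u2 [set: 'I_13])%:R)) //.
  by rewrite ler_nat; apply/Phi_part_mono/finset.subsetT.
by rewrite addrAC lerDr subr_ge0.
Qed.

Lemma Phi_eps_not_cc : 0 < eps -> (2 : F1) = 0 -> (2 : F2) != 0 ->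
  row_free u1 -> row_free u2 -> ~ cc_representable (Phi_eps u1 u2 eps).
Proof.
move=> eps0 z2 nz2 fu1 fu2 ccPhi.
pose o i (lt_i : (i < 7)%N) : 'I_7 := Ordinal lt_i.
pose o' i (lt_i : (i < 13)%N) : 'I_13 := Ordinal lt_i.
pose s i lt_i : {set X} := inl @: [set @o i lt_i].
pose s' i lt_i : {set X} := inr @: [set @o' i lt_i].
(* The indices follow the roles u1, u2, u3, u1+u2+u3, u2+u3, u1+u3, u1+u2; in the second component
   they continue with u4, u3+u4, u5, u3+u5. *)
have := lin_form_ge0_cc (lin_form_separation R
  (@s 0 isT) (@s 1 isT) (@s 2 isT) (@s 5 isT) (@s 4 isT) (@s 6 isT) (@s 3 isT)
  (inl @: [set: 'I_7])
  (@s' 0 isT) (@s' 1 isT) (@s' 2 isT) (@s' 5 isT) (@s' 9 isT) (@s' 8 isT)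
  (@s' 7 isT) (@s' 3 isT) (@s' 10 isT) (@s' 4 isT) (@s' 11 isT)
  (inr @: [set: 'I_13]))
  (fun g => @separation_ge0 _ _ g _ _ _ _ _ _ _ _ _ _ _ _ _ _ _ _ _ _ _ _)
  ccPhi.
rewrite fano_total_imset nonfano_total_imset Phi_eps_inl Phi_eps_inr.
rewrite {1}/Phi_eps /truncate Phi_setT.
rewrite (min_idPr _); last by rewrite lerBlDr lerDl ltW.
pose g1 S : R := (Phi1 u1 S)%:R; pose g2 S : R := (Phi2 u2 S)%:R.
rewrite (_ : (fun A => _) = g1); last by apply/funext => S; exact: Phi_eps_inl.
rewrite (_ : (fun A => _) = g2); last by apply/funext => S; exact: Phi_eps_inr.
have t1 : fano_total g1 [set @o 0 isT] [set @o 1 isT] [set @o 2 isT]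
   [set @o 5 isT] [set @o 4 isT] [set @o 6 isT] [set @o 3 isT] [set: 'I_7] <= 0.
  apply: (@fano_total_tight R _ F1 k1 (fun e : 'I_7 => elt_vec supp1 u1 e)) => //.
  - by apply: elt_vecD => -[[|[|[|]]]].
  - by apply: elt_vecD => -[[|[|[|]]]].
  - by apply: elt_vecD => -[[|[|[|]]]].
  - by apply: elt_vecD => -[[|[|[|]]]].
  - rewrite ler_nat; apply: Phi_part_ge => // j.
    exists (widen_ord (isT : 3 <= 7)%N j); last by case: j => -[|[|[]]].
    by rewrite !inE -!val_eqE; case: j => -[|[|[]]].
  - by move=> S; rewrite ler_nat; apply: Phi_part_le.
have t2 : nonfano_total g2 [set @o' 0 isT] [set @o' 1 isT] [set @o' 2 isT]
   [set @o' 5 isT] [set @o' 9 isT] [set @o' 8 isT] [set @o' 7 isT] [set @o' 3 isT]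
   [set @o' 10 isT] [set @o' 4 isT] [set @o' 11 isT] [set: 'I_13] <= 0.
  pose v2 (e : 'I_13) := elt_vec supp2 u2 e.
  have g2E S : g2 S = (\rank (spn (fun e => <<v2 e>>%MS) S))%:R by [].
  have ge5 : 5 <= g2 ([set @o' 0 isT] :|: [set @o' 1 isT] :|: [set @o' 2 isT]
      :|: [set @o' 3 isT] :|: [set @o' 4 isT]).
    rewrite ler_nat; apply: Phi_part_ge => // j.
    exists (widen_ord (isT : 5 <= 13)%N j); last by case: j => -[|[|[|[|[|]]]]].
    by rewrite !inE -!val_eqE; case: j => -[|[|[|[|[|]]]]].
  apply: (nonfano_total_tight g2E) => //.
  - by apply: elt_vecD => -[[|[|[|[|[|]]]]]].
  - by apply: elt_vecD => -[[|[|[|[|[|]]]]]].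
  - by apply: elt_vecD => -[[|[|[|[|[|]]]]]].
  - by apply: elt_vecD => -[[|[|[|[|[|]]]]]].
  - exact: (rank_triple_ge3 g2E ge5).
  - by move=> S; rewrite ler_nat; apply: Phi_part_le.
  - by apply: elt_vecD => -[[|[|[|[|[|]]]]]].
  - by apply: elt_vecD => -[[|[|[|[|[|]]]]]].
(* The component ranks cancel, and the form takes a value of at most [- eps], although it should be
   nonnegative. *)
lra.
Qed.
End Phi.

Theorem theorem8 (R : realType) (n : nat) (n_gt0 : (0 < n)%N)
  (Hn : forall h : {set 'I_n} -> R,
          cc_representable h -> almost_representable h)
  (c : {set 'I_n} -> R) (Hc : lin_rank_ineq c) :
  (forall (X : finType) (h : {set X} -> R),
     polymatroid h -> cc_representable h ->
     forall eps : R, 0 <= eps <= h [set: X] ->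
     satisfies_ineq c (truncate h eps))
  /\
  (forall (F1 F2 : finFieldType) (p2 : nat) (k1 k2 : nat)
          (u1 : 'M[F1]_(3, k1)) (u2 : 'M[F2]_(5, k2)) (eps : R),
     (2 \in [pchar F1])%N -> (p2 \in [pchar F2])%N -> odd p2 ->
     row_free u1 -> row_free u2 ->
     0 < eps <= Num.min (Phi1 u1 [set: 'I_7])%:R (Phi2 u2 [set: 'I_13])%:R ->
     satisfies_ineq c (Phi_eps u1 u2 eps) /\
     ~ cc_representable (Phi_eps u1 u2 eps)).
Proof.
split=> [X h _ hcc eps /andP[_ le_eps]|].
  exact: truncate_satisfies.
move=> F1 F2 p2 k1 k2 u1 u2 eps char1 char2 odd_p2 fu1 fu2.
rewrite le_min => /and3P[eps0 le1 le2]; split.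
  apply: truncate_satisfies => //; first exact: cc_representable_Phi.
  by rewrite Phi_setT (le_trans le1) // lerDl.
apply: Phi_eps_not_cc => //; first exact: pcharf0.
(* If 2 vanished in [F2], its characteristic [p2] would be 2, which is not odd. *)
apply/negP => /eqP z2.
have /(_ 2) := pcharf_eq char2; rewrite !inE z2 eqxx /= => /esym/eqP p22.
by rewrite -p22 in odd_p2.
Qed.
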